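(* Let $B$ be a P-domain, let $n\geq 1$, and let $M_1,\dots,M_n$ be distinct maximal ideals of $B$ such that none of them is a valued prime of $B$. Assume that all the fields $B/M_i$ are isomorphic to the same field $K$, by isomorphisms $\sigma_i:B/M_i\to K$, $i=1,\dots,n$. Set $I=M_1\cap\cdots\cap M_n$, and let $\pi:B\to K^n$ be the composition of the canonical morphism $B\to B/I$, the Chinese Remainder Theorem morphism $B/I\to B/M_1\times\cdots\times B/M_n$ and $(\sigma_1,\dots,\sigma_n):B/M_1\times\cdots\times B/M_n\to K^n$ (so $\pi(b)=(\sigma_1(b+M_1),\dots,\sigma_n(b+M_n))$). Identify $K$ with its diagonal image $\{(x,\dots,x)\mid x\in K\}$ in $K^n$. Then the pullback domain $A=\pi^{-1}(K)$ is perinormal.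
   Context: All rings, except products of fields, are commutative unitary integral domains. An overring of a domain $A$ is a ring $C$ between $A$ and the quotient field of $A$. An overring $C$ of $A$ is a going down overring if going down holds for $A\subseteq C$, that is, for each $Q\in\mathrm{Spec}(C)$ the induced map $\mathrm{Spec}(C_Q)\to\mathrm{Spec}(A_{Q\cap A})$ is surjective. $A$ is perinormal if every going down overring of $A$ is flat as an $A$-module. A prime ideal $P$ of a domain $B$ is a valued prime if $B_P$ is a valuation domain (fields count as valuation domains). A domain $B$ is a P-domain if $B_P$ is a valuation domain for every prime ideal $P$ of $B$ which is minimal over an ideal of the form $Ba:b=\{x\in B\mid xb\in Ba\}$ with $a,b\in B$. *)

(* Defs.v *)
From HB Require Import structures.
From mathcomp Require Import all_boot all_order all_algebra.
From mathcomp Require Import boolp.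

Set Implicit Arguments.
Unset Strict Implicit.
Unset Printing Implicit Defensive.

Import GRing.Theory.
Local Open Scope ring_scope.
Local Open Scope quotient_scope.

(* Ideals are boolean predicates, as in ring_quotient; by [asbool] this is no
   restriction.  Members of [idealr R] and [prime_idealr R] are proper. *)

Section Ideals.
Variable R : comNzRingType.

Definition maximal_ideal (M : idealr R) : Prop :=
  forall J : idealr R, {subset M <= J} -> J =i M.

Definition minimal_prime_over (I : {pred R}) (P : prime_idealr R) : Prop :=
  {subset I <= P} /\
  forall Q : prime_idealr R, {subset I <= Q} -> {subset Q <= P} -> Q =i P.

(* Ra : b *)
Definition colon (a b : R) : {pred R} :=
  [pred x | `[< exists c, x * b = c * a >]].

End Ideals.

Section Spec.
Variables (R S : comNzRingType) (f : {rmorphism R -> S}).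

Definition contraction (Q : {pred S}) : {pred R} := [pred x | f x \in Q].

Section Instances.
Variable Q : prime_idealr S.

Fact contraction_idealr : idealr_closed (contraction Q).
Proof.
split; rewrite ?inE ?rmorph0 ?rmorph1 ?rpred0 ?idealr1 //.
by move=> a u v; rewrite !inE rmorphD rmorphM => uQ vQ; rewrite rpredD ?idealMr.
Qed.

Fact contraction_prime : prime_idealr_closed (contraction Q).
Proof. by move=> u v; rewrite !inE rmorphM prime_idealrM. Qed.

HB.instance Definition _ := isIdealr.Build R (contraction Q) contraction_idealr.
HB.instance Definition _ :=
  isPrimeIdealrClosed.Build R (contraction Q) contraction_prime.
End Instances.

Definition Spec_map (Q : prime_idealr S) : prime_idealr R := contraction Q.

Definition Spec_surjective : Prop :=
  forall P : prime_idealr R, exists Q : prime_idealr S, Spec_map Q =i P.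

End Spec.

(* The tensor product N (x)_R M is the quotient of the formal sums of symbols
   n (x) m, written as sequences of pairs, by the congruence [tensor_eq]
   generated by commutativity and bilinearity.  Opposites need no generator:
   (n, m) + (- n, m) = (0, m) = 0. *)
Section Flat.
Variable R : comNzRingType.

Inductive tensor_eq (N M : lmodType R) : seq (N * M) -> seq (N * M) -> Prop :=
| tensor_refl s : tensor_eq s s
| tensor_sym s t : tensor_eq s t -> tensor_eq t s
| tensor_trans s t u : tensor_eq s t -> tensor_eq t u -> tensor_eq s u
| tensor_cat s s' t t' :
    tensor_eq s s' -> tensor_eq t t' -> tensor_eq (s ++ t) (s' ++ t')
| tensor_catC s t : tensor_eq (s ++ t) (t ++ s)
| tensor_0l m : tensor_eq [:: (0, m)] [::]
| tensor_Dl n n' m : tensor_eq [:: (n + n', m)] [:: (n, m); (n', m)]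
| tensor_Dr n m m' : tensor_eq [:: (n, m + m')] [:: (n, m); (n, m')]
| tensor_Z a n m : tensor_eq [:: (a *: n, m)] [:: (n, a *: m)].

Definition tensor_map (N N' M : lmodType R) (f : N -> N') (s : seq (N * M)) :
  seq (N' * M) := [seq (f p.1, p.2) | p <- s].

(* M is flat: f (x) M is injective for every injective linear map f. *)
Definition flat (M : lmodType R) : Prop :=
  forall (N N' : lmodType R) (f : {linear N -> N'}), injective f ->
  forall s t : seq (N * M),
    tensor_eq (tensor_map f s) (tensor_map f t) -> tensor_eq s t.

End Flat.

Section RestrictScalars.
Variables (R S : comNzRingType) (f : {rmorphism R -> S}).

Definition restrict_scalars of {rmorphism R -> S} : Type := S.
Local Notation V := (restrict_scalars f).

HB.instance Definition _ := GRing.Zmodule.on V.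

Definition rscale (a : R) (x : V) : V := f a * (x : S).

Fact rscaleA a b x : rscale a (rscale b x) = rscale (a * b) x.
Proof. by rewrite /rscale rmorphM mulrA. Qed.
Fact rscale1 : left_id 1 rscale.
Proof. by move=> x; rewrite /rscale rmorph1 mul1r. Qed.
Fact rscaleDr : right_distributive rscale +%R.
Proof. by move=> a x y; rewrite /rscale -mulrDr. Qed.
Fact rscaleDl x : {morph rscale^~ x : a b / a + b}.
Proof. by move=> a b; rewrite /rscale rmorphD mulrDl. Qed.

HB.instance Definition _ :=
  GRing.Zmodule_isLmodule.Build R V rscaleA rscale1 rscaleDr rscaleDl.
End RestrictScalars.

(* Domains are handled as subrings of a field F, which need not be their
   quotient field. *)
Section Subrings.
Variable F : fieldType.

Definition subring (S : subringClosed F) : Type := {x : F | x \in S}.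

Section Instances.
Variable S : subringClosed F.
HB.instance Definition _ := SubChoice.on (subring S).
HB.instance Definition _ :=
  [SubChoice_isSubComNzRing of subring S by <:].
End Instances.

Definition to_field (S : subringClosed F) : {rmorphism subring S -> F} :=
  val : subring S -> F.

Definition quotient_field (S : subringClosed F) : {pred F} :=
  [pred x | `[< exists a b : subring S, b != 0 /\ x = val a / val b >]].

Section Inclusion.
Variables (A C : subringClosed F) (sAC : {subset A <= C}).

Definition incl_fun (x : subring A) : subring C := Sub (val x) (sAC (valP x)).

Fact incl_is_zmod_morphism : zmod_morphism incl_fun.
Proof. by move=> x y; apply/val_inj; rewrite !(SubK, rmorphB). Qed.
Fact incl_is_monoid_morphism : monoid_morphism incl_fun.
Proof. by split=> [|x y]; apply/val_inj; rewrite !(SubK, rmorph1, rmorphM). Qed.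

HB.instance Definition _ := GRing.isZmodMorphism.Build
  (subring A) (subring C) incl_fun incl_is_zmod_morphism.
HB.instance Definition _ := GRing.isMonoidMorphism.Build
  (subring A) (subring C) incl_fun incl_is_monoid_morphism.

Definition incl : {rmorphism subring A -> subring C} := incl_fun.
End Inclusion.

Definition valuation_domain (V : subringClosed F) : Prop :=
  forall a b : subring V, (exists c, a = c * b) \/ (exists c, b = c * a).

End Subrings.

(* R_P = {j a / j s | s \notin P}, computed in F; meaningful for j injective. *)
Section Localization.
Variables (R : comNzRingType) (F : fieldType) (j : {rmorphism R -> F}).

Definition localization_pred (P : {pred R}) : {pred F} :=
  [pred x | `[< exists a s, s \notin P /\ x = j a / j s >]].

Variable P : prime_idealr R.

Fact localization_subring : subring_closed (localization_pred P).
Proof.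
have notP1 : 1 \notin P by rewrite idealr1.
have notPM s t : s \notin P -> t \notin P -> s * t \notin P.
  by move=> sP tP; rewrite prime_idealrM negb_or sP.
split=> [|x y|x y]; rewrite ?inE.
- by apply/asboolP; exists 1, 1; rewrite rmorph1 divr1.
- move=> /asboolP[a [s [sP ->]]] /asboolP[b [t [tP ->]]]; apply/asboolP.
  have [js0|js0] := eqVneq (j s) 0.
    by exists (- b), t; rewrite js0 invr0 mulr0 sub0r rmorphN mulNr.
  have [jt0|jt0] := eqVneq (j t) 0.
    by exists a, s; rewrite jt0 invr0 mulr0 subr0.
  exists (a * t - b * s), (s * t); split; first exact: notPM.
  by rewrite rmorphB !rmorphM -[in LHS]mulNr addf_div // mulNr.
- move=> /asboolP[a [s [sP ->]]] /asboolP[b [t [tP ->]]]; apply/asboolP.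
  exists (a * b), (s * t); split; first exact: notPM.
  by rewrite !rmorphM mulf_div.
Qed.

HB.instance Definition _ :=
  GRing.isSubringClosed.Build F (localization_pred P) localization_subring.

Definition localization : subringClosed F := localization_pred P.

Definition valued_prime : Prop := valuation_domain localization.
End Localization.

Section GoingDown.
Variables (F : fieldType) (A C : subringClosed F) (sAC : {subset A <= C}).

Fact localization_incl (Q : prime_idealr (subring C)) :
  {subset localization (to_field A) (Spec_map (incl sAC) Q)
       <= localization (to_field C) Q}.
Proof.
move=> x /asboolP[a [s [sQ ->]]]; apply/asboolP.
by exists (incl sAC a), (incl sAC s).
Qed.

Definition going_down : Prop :=
  forall Q : prime_idealr (subring C),
    Spec_surjective (incl (@localization_incl Q)).
End GoingDown.

Definition perinormal (F : fieldType) (A : subringClosed F) : Prop :=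
  forall (C : subringClosed F) (sAC : {subset A <= C}),
    {subset C <= quotient_field A} ->
    going_down sAC -> flat (restrict_scalars (incl sAC)).

Section Domains.
Variable B : idomainType.

Definition embedding : {rmorphism B -> {fraction B}} := @FracField.tofrac B.

Definition P_domain : Prop :=
  forall P : prime_idealr B,
    (exists a b : B, minimal_prime_over (colon a b) P) ->
    valued_prime embedding P.

Definition embedded_pred (S : {pred B}) : {pred {fraction B}} :=
  [pred x | `[< exists2 b, b \in S & x = embedding b >]].

Fact embedded_subring (S : subringClosed B) : subring_closed (embedded_pred S).
Proof.
split=> [|x y|x y]; rewrite ?inE.
- by apply/asboolP; exists 1; rewrite ?rpred1 ?rmorph1.
- move=> /asboolP[a aS ->] /asboolP[b bS ->]; apply/asboolP.
  by exists (a - b); rewrite ?rpredB ?rmorphB.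
- move=> /asboolP[a aS ->] /asboolP[b bS ->]; apply/asboolP.
  by exists (a * b); rewrite ?rpredM ?rmorphM.
Qed.

HB.instance Definition _ (S : subringClosed B) :=
  GRing.isSubringClosed.Build {fraction B} (embedded_pred S)
    (embedded_subring S).


Definition embedded (S : subringClosed B) : subringClosed {fraction B} :=
  embedded_pred S.

End Domains.

Section Pullback.
Variables (B : idomainType) (K : fieldType) (n : nat).
Variables (M : 'I_n -> prime_idealr B).
Variables (sigma : forall i, {rmorphism {ideal_quot (M i)} -> K}).

Definition residues (b : B) : {ffun 'I_n -> K} :=
  [ffun i => sigma i (\pi_{ideal_quot (M i)} b)].

Definition pullback_pred : {pred B} :=
  [pred b | `[< exists x : K, residues b = [ffun=> x] >]].

Fact pullback_subring : subring_closed pullback_pred.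
Proof.
have resP b : reflect (exists x, forall i, sigma i (\pi b) = x)
    (b \in pullback_pred).
  apply: (iffP (asboolP _)) => -[x bx]; exists x.
    by move=> i; have /ffunP/(_ i) := bx; rewrite !ffunE.
  by apply/ffunP=> i; rewrite !ffunE bx.
split=> [|a b|a b].
- by apply/resP; exists 1 => i; rewrite !rmorph1.
- move=> /resP[x ax] /resP[y bY]; apply/resP; exists (x - y) => i.
  by rewrite !rmorphB ax bY.
- move=> /resP[x ax] /resP[y bY]; apply/resP; exists (x * y) => i.
  by rewrite !rmorphM ax bY.
Qed.

HB.instance Definition _ :=
  GRing.isSubringClosed.Build B pullback_pred pullback_subring.

Definition pullback : subringClosed B := pullback_pred.
End Pullback.

(* Main.v *)
(* A going down overring C of A is flat as soon as A_P = C_Q for every prime Q of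
   C, with P = Q :&: A.  Let x be in C_Q.  A valued prime P1 of B does not contain
   I, since no M_i is valued, so B_P1 is a localization of A; if P1 :&: A is inside
   P, going down gives a prime of C_Q over it, which forces x into B_P1 because a
   valuation domain is maximal for domination.  In a P-domain the denominator
   ideal of x is contained in a valued prime whenever it is proper, so s x is in B
   for some s in A \ P.  If I is not contained in P, multiply s by an element of
   I \ P.  If P = I, the image of s x in K^n lies in a local K-subalgebra of K^n,
   hence on the diagonal, and s x is in A. *)

From HB Require Import structures.
Require Import Defs.
From mathcomp Require Import all_boot all_order all_algebra.
From mathcomp Require Import boolp classical_sets.
From mathcomp Require Import ring.

Set Implicit Arguments.
Unset Strict Implicit.
Unset Printing Implicit Defensive.

Import GRing.Theory.
Local Open Scope ring_scope.

(** * Primes disjoint from a multiplicative set and minimal over an ideal *)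

Section Primes.
Variable R : comNzRingType.
Implicit Types (D : {pred R}) (S : set R).

Lemma exists_prime_idealr D : idealr_closed D -> prime_idealr_closed D ->
  exists P : prime_idealr R, P =i D.
Proof.
move=> idD prD.
pose iD := isIdealr.Build R D idD.
pose pD := isPrimeIdealrClosed.Build R D prD.
pose P : prime_idealr R := HB.pack D iD pD.
by exists P.
Qed.

(** Zorn's lemma is applied to multiplicative sets containing [S] and disjoint from [D]. The
    complement of a maximal one is a prime ideal, and maximality of the set becomes minimality of
    the prime over [D]. *)
Lemma exists_minimal_prime D S :
    0 \in D -> (forall a, {in D &, forall u v, a * u + v \in D}) ->
    S 1 -> (forall x y, S x -> S y -> S (x * y)) ->
    (forall x, S x -> x \notin D) ->
  exists P : prime_idealr R, minimal_prime_over D P /\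
    forall x, S x -> x \notin P.
Proof.
move=> D0 DZ S1 SM SD.
have DM a u : u \in D -> a * u \in D by move=> uD; rewrite -[_ * _]addr0 DZ.
have DD u v : u \in D -> v \in D -> u + v \in D.
  by move=> uD vD; rewrite -[u]mul1r DZ.
(* Containing [S] is required only of a nonempty [X], since the union of the empty chain must be
   good too. A maximal [X] still contains [S], because [S] itself is good. *)
pose good (X : set R) :=
  [/\ forall x y, X x -> X y -> X (x * y), forall x, X x -> x \notin D
    & forall x, X x -> (S `<=` X)%classic].
have goodS : good S by split=> // x _.
have [|X [[XM XD XS] Xmax]] := @Zorn_bigcup R good.
  move=> F Fgood Ftot; split.
  - move=> x y [Y FY Yx] [Z FZ Zy]; have [YZ|ZY] := Ftot _ _ FY FZ.
      by exists Z => //; have [+ _ _] := Fgood _ FZ; apply=> //; apply: YZ.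
    by exists Y => //; have [+ _ _] := Fgood _ FY; apply=> //; apply: ZY.
  - by move=> x [Y FY Yx]; have [_ + _] := Fgood _ FY; apply.
  - move=> x [Y FY Yx] y Sy; exists Y => //.
    by have [_ _ /(_ _ Yx)] := Fgood _ FY; apply.
have {}XS : (S `<=` X)%classic.
  have [[x /XS//]|X0] := pselect (exists x, X x).
  case: (Xmax S) => //; split; last by move=> /(_ _ S1) X1; apply: X0; exists 1.
  by move=> x Xx; case: X0; exists x.
have X1 : X 1 := XS _ S1.
(* Since [X] is maximal, adjoining any [x] outside [X] makes it meet [D]. *)
have XC x : ~ X x -> exists s n, X s /\ s * x ^+ n \in D.
  move=> Xx; pose Y := [set y | exists s n, X s /\ y = s * x ^+ n]%classic.
  apply: contrapT => noD; apply: (Xmax Y).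
    split; first by move=> y Xy; exists y, 0%N; rewrite expr0 mulr1.
    by move=> /(_ x); apply: contra_not Xx; apply; exists 1, 1%N; rewrite mul1r.
  split.
  - move=> y z [s [k [Xs ->]]] [t [l [Xt ->]]]; exists (s * t), (k + l)%N.
    by split; [exact: XM|rewrite exprD mulrACA].
  - by move=> y [s [k [Xs ->]]]; apply/negP => sD; apply: noD; exists s, k.
  - by move=> _ _ y /XS Xy; exists y, 0%N; rewrite expr0 mulr1.
pose C : {pred R} := [pred x | x \notin X].
have CP x : reflect (exists s n, X s /\ s * x ^+ n \in D) (x \in C).
  apply: (iffP negP) => [Xx|[s [n [Xs sxD]]] /set_mem Xx].
    by apply: XC => /mem_set.
  have: X (s * x ^+ n).
    elim: n {sxD} => [|n IHn]; first by rewrite mulr1.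
    by rewrite exprSr mulrA; apply: XM.
  by move=> /XD; rewrite sxD.
have [||P PE] := @exists_prime_idealr C.
- split.
  + by apply/CP; exists 1, 1%N; rewrite mulr0.
  + by rewrite inE negbK; apply: mem_set.
  + move=> a u v /CP[s [k [Xs uD]]] /CP[t [l [Xt vD]]].
    (* With exponent [k + l], every term of the binomial expansion contains [v ^+ l] or [u ^+ k], so
       [t] or [s] brings it into [D]. *)
    apply/CP; exists (s * t), (k + l)%N; split; first exact: XM.
    rewrite exprDn mulr_sumr; apply: (big_ind (fun y => y \in D)) => // i _.
    set c := 'C(_, _); have [li|/ltnW il] := leqP l i.
      rewrite -(subnK li) [v ^+ _]exprD; set p := _ ^+ _; set q := _ ^+ (_ - _).
      suff -> : s * t * ((p * (q * v ^+ l)) *+ c) = p * q * s *+ c * (t * v ^+ l).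
        exact: DM.
      by ring.
    rewrite -addnBA // [(a * u) ^+ _]exprD exprMn.
    set p := _ ^+ (_ - _); set q := v ^+ _.
    suff -> : s * t * ((a ^+ k * u ^+ k * p * q) *+ c)
            = a ^+ k * p * q * t *+ c * (s * u ^+ k) by exact: DM.
    by ring.
- move=> x y; rewrite [_ \in C]inE => /negP Xxy; apply/orP.
  have [Xx|] := boolP (x \in X); last by left.
  right; apply/negP => Xy; apply/Xxy/mem_set.
  by apply: XM; apply: set_mem.
exists P; split; last by move=> x /XS Xx; rewrite PE inE negbK; apply: mem_set.
split=> [x xD|Q DQ QP x].
  by rewrite PE; apply/CP; exists 1, 1%N; rewrite mul1r.
(* A prime [Q] inside [P] avoids [X], so [s * x ^+ n] in [D] forces [x] into [Q]. *)
apply/idP/idP => [/QP//|]; rewrite PE => /CP[s [n [Xs /DQ]]].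
rewrite prime_idealrM => /orP[sQ|].
  by have := QP _ sQ; rewrite PE inE mem_set.
elim: n => [|n IHn]; first by rewrite idealr1.
by rewrite exprS prime_idealrM => /orP[].
Qed.
End Primes.

(** * Calculus of formal sums in the tensor product *)

Section Tensor.
Variables (R : comNzRingType) (N M : lmodType R).
Implicit Types (s t : seq (N * M)).

Lemma tensor_0r (n : N) : tensor_eq [:: (n, 0 : M)] [::].
Proof.
rewrite -[0 in X in tensor_eq X](scale0r (0 : M)).
apply: tensor_trans (tensor_sym (tensor_Z _ _ _)) _.
by rewrite scale0r; apply: tensor_0l.
Qed.

Lemma tensor_sumr I (l : seq I) (n : N) (m : I -> M) :
  tensor_eq [seq (n, m i) | i <- l] [:: (n, \sum_(i <- l) m i)].
Proof.
elim: l => [|i l IHl] /=; first by rewrite big_nil; apply/tensor_sym/tensor_0r.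
rewrite big_cons; apply: tensor_trans (tensor_sym (tensor_Dr _ _ _)).
by apply: (@tensor_cat _ _ _ [:: _] [:: _] _ [:: _]) => //; apply: tensor_refl.
Qed.

Lemma tensor_addl I (l : seq I) (n n' : I -> N) (m : I -> M) :
  tensor_eq [seq (n i + n' i, m i) | i <- l]
    ([seq (n i, m i) | i <- l] ++ [seq (n' i, m i) | i <- l]).
Proof.
elim: l => [|i l IHl] /=; first exact: tensor_refl.
apply: tensor_trans (tensor_cat (s := [:: _]) (tensor_Dl _ _ _) IHl) _.
apply: (@tensor_cat _ _ _ [:: _] [:: _]); first exact: tensor_refl.
rewrite -[X in tensor_eq X]cat1s -[X in tensor_eq _ (_ ++ X)]cat1s !catA.
apply: tensor_cat; last exact: tensor_refl.
exact: tensor_catC.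
Qed.

Lemma tensor_sum0 I (l : seq I) (m : I -> M) :
  tensor_eq [seq (0 : N, m i) | i <- l] [::].
Proof.
elim: l => [|i l IHl] /=; first exact: tensor_refl.
exact: (tensor_cat (s := [:: _]) (s' := [::]) (tensor_0l _ _) IHl).
Qed.

End Tensor.

(** * Flatness of an extension that is locally an equality *)

Section LocallyEqual.
Variables (R S : comNzRingType) (f : {rmorphism R -> S}).
Hypothesis f_inj : injective f.
Hypothesis f_local : forall (Q : prime_idealr S) (c : S),
  exists a b : R, f a \notin Q /\ f a * c = f b.

Local Notation V := (restrict_scalars f).

(* Junk value [0] when [f a * c] is not in the image of [f]. *)
Definition cleared (a : R) (c : S) : R := xget 0 [set b | f a * c = f b]%classic.

Definition clears (a : R) (c : S) := exists b, f a * c = f b.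

Let clearedP a c : clears a c -> f (cleared a c) = f a * c.
Proof. by move=> [b ab]; rewrite /cleared; case: xgetP => [x _ /= <-//|/(_ b)]. Qed.

Let clearsM a b c : clears b c -> clears (a * b) c.
Proof. by move=> [x xE]; exists (a * x); rewrite !rmorphM -mulrA xE. Qed.

Let clearedM a b c : clears b c -> cleared (a * b) c = a * cleared b c.
Proof.
move=> bc; apply: f_inj; rewrite clearedP ?rmorphM ?clearedP ?mulrA //.
exact: clearsM.
Qed.

Section Module.
Variable N : lmodType R.
Implicit Types (s t : seq (N * V)).

Definition clears_all a s := forall p, p \in s -> clears a p.2.
(** When [a] clears every right factor of [s], the tensor [a s] equals [n (x) 1] for this element
    [n]. *)
Definition cleared_sum a s : N := \sum_(p <- s) cleared a p.2 *: p.1.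

Let clears_all_mul a b s : clears_all b s -> clears_all (a * b) s.
Proof. by move=> bs p /bs; apply: clearsM. Qed.

Let cleared_sum_mul a b s :
  clears_all b s -> cleared_sum (a * b) s = a *: cleared_sum b s.
Proof.
move=> bs; rewrite /cleared_sum scaler_sumr; apply: eq_big_seq => p /bs pb.
by rewrite clearedM // scalerA.
Qed.

Let exists_clears_all (Q : prime_idealr S) s : exists2 a, f a \notin Q & clears_all a s.
Proof.
elim: s => [|p s [a aQ as_]]; first by exists 1; rewrite // rmorph1 idealr1.
have [b [x [bQ bx]]] := f_local Q p.2.
exists (a * b); first by rewrite rmorphM prime_idealrM negb_or aQ.
move=> q; rewrite inE => /orP[/eqP->|qs]; first by apply: clearsM; exists x.
by rewrite mulrC; apply: clears_all_mul qs.
Qed.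

Definition agree a s t :=
  [/\ clears_all a s, clears_all a t & cleared_sum a s = cleared_sum a t].

Let agree_mul a b s t : agree b s t -> agree (a * b) s t.
Proof.
by move=> [bs bt st]; split; rewrite ?cleared_sum_mul ?st //; apply: clears_all_mul.
Qed.

Let clears_all_cat a s t : clears_all a s -> clears_all a t -> clears_all a (s ++ t).
Proof. by move=> As At p; rewrite mem_cat => /orP[/As|/At]. Qed.

Let cleared_sum_cat a s t : cleared_sum a (s ++ t) = cleared_sum a s + cleared_sum a t.
Proof. exact: big_cat. Qed.

(** Induction on the derivation. Multipliers of several premises are combined by multiplication,
    which keeps their image outside the prime [Q]. For the bilinearity generators, injectivity of
    [f] makes the cleared numerators unique, hence additive and linear. *)
Lemma tensor_eq_agree (Q : prime_idealr S) s t : tensor_eq s t ->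
  exists2 a, f a \notin Q & agree a s t.
Proof.
have cleared_sum1 a (p : N * V) : cleared_sum a [:: p] = cleared a p.2 *: p.1.
  by rewrite /cleared_sum big_seq1.
have notQM a b : f a \notin Q -> f b \notin Q -> f (a * b) \notin Q.
  by move=> aQ bQ; rewrite rmorphM prime_idealrM negb_or aQ.
elim=> {s t} [s|s t _ [a aQ [As At st]]|s t u _ [a aQ ast] _ [b bQ btu]
  |s s' t t' _ [a aQ ast] _ [b bQ btu]|s t|m|n n' m|n m m'|r n m].
- by have [a aQ As] := exists_clears_all Q s; exists a.
- by exists a.
- exists (a * b); first exact: notQM.
  have [_ bu tu] := agree_mul a btu.
  have [As _ st] := agree_mul b ast.
  by rewrite mulrC in As st; split=> //; rewrite st tu.
- exists (a * b); first exact: notQM.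
  have [bt bt' tt'] := agree_mul a btu.
  have [] := agree_mul b ast; rewrite ![b * a]mulrC => As As' ss'.
  by split; rewrite ?cleared_sum_cat ?ss' ?tt' //; apply: clears_all_cat.
- have [a aQ As] := exists_clears_all Q (s ++ t); exists a => //; split=> //.
    by move=> p pst; apply: As; move: pst; rewrite !mem_cat orbC.
  by rewrite !cleared_sum_cat addrC.
- have [a aQ As] := exists_clears_all Q [:: (0, m)]; exists a => //; split=> //.
  by rewrite cleared_sum1 /= scaler0 /cleared_sum big_nil.
- have [a aQ As] := exists_clears_all Q [:: (n, m)]; exists a => //.
  have am : clears a m by have := As (n, m); apply; rewrite inE.
  have cl x : clears_all a [:: (x, m)] by move=> p; rewrite inE => /eqP->.
  split=> //; first by rewrite -cat1s; apply: clears_all_cat.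
  by rewrite cleared_sum1 /= -cat1s cleared_sum_cat !cleared_sum1 /= scalerDr.
- have [a aQ As] := exists_clears_all Q [:: (n, m); (n, m')]; exists a => //.
  have am : clears a m by have := As (n, m); apply; rewrite !inE eqxx.
  have am' : clears a m' by have := As (n, m'); apply; rewrite !inE eqxx orbT.
  have fE : f (cleared a m + cleared a m') = f a * (m + m').
    by rewrite rmorphD !clearedP // -mulrDr.
  have amm' : clears a (m + m') by exists (cleared a m + cleared a m').
  split=> //; first by move=> p; rewrite inE => /eqP->.
  rewrite cleared_sum1 -cat1s cleared_sum_cat !cleared_sum1 /= -scalerDl.
  by congr (_ *: _); apply: f_inj; rewrite clearedP.
- have [a aQ As] := exists_clears_all Q [:: (n, m)]; exists a => //.
  have am : clears a m by have := As (n, m); apply; rewrite inE.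
  have fE : f (r * cleared a m) = f a * (r *: m).
    by rewrite rmorphM clearedP // mulrCA.
  have arm : clears a (r *: m) by exists (r * cleared a m).
  split; try by move=> p; rewrite inE => /eqP->.
  rewrite !cleared_sum1 /= scalerA; congr (_ *: _).
  by apply: f_inj; rewrite clearedP // -fE mulrC.
Qed.

(* If [1 = \sum f a * d] then [s = \sum (a s) (x) d], where [a s] is the image of an
   element of [N]. *)
Lemma tensor_eq_cleared_sum (l : seq (R * S)) s :
    1 = \sum_(i <- l) f i.1 * i.2 -> (forall i, i \in l -> clears_all i.1 s) ->
  tensor_eq s [seq (cleared_sum i.1 s, i.2 : V) | i <- l].
Proof.
move=> l1; elim: s => [|p s IHs] ls.
  apply: tensor_sym; rewrite /cleared_sum; under eq_map do rewrite big_nil.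
  exact: tensor_sum0.
have {}IHs : tensor_eq s [seq (cleared_sum i.1 s, i.2 : V) | i <- l].
  by apply: IHs => i /ls + q qs; apply; rewrite inE qs orbT.
under eq_map do rewrite /cleared_sum big_cons.
apply/tensor_sym/(tensor_trans (tensor_addl _ _ _ _))/tensor_sym.
apply: (tensor_cat (s := [:: _])) IHs.
(* The right factor [m] is the sum of the [(f a * m) * d], and each [f a * m] comes from [R], so it
   can be moved to the left factor. *)
have -> : [:: p] = [:: (p.1, \sum_(i <- l) cleared i.1 p.2 *: (i.2 : V))].
  case: p ls => n m ls /=; congr [:: (_, _)].
  rewrite -[LHS]mul1r l1 mulr_suml; apply: eq_big_seq => i il.
  transitivity (f (cleared i.1 m) * i.2); last by [].
  rewrite clearedP 1?mulrAC //.
  by have := ls _ il (n, m); apply; rewrite inE eqxx.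
apply: tensor_trans (tensor_sym (tensor_sumr _ _ _)) _.
elim: l {l1 ls} => [|i l IHl] /=; first exact: tensor_refl.
apply: (tensor_cat (s := [:: _]) (s' := [:: _])) IHl.
exact/tensor_sym/tensor_Z.
Qed.

End Module.

(** Injectivity of [g] brings the agreement of cleared sums back from [N'] to [N]. The multipliers
    for which [s] and [t] agree have images contained in no single prime of [S], so these images
    generate the unit ideal [D]. The resulting partition of unity recovers both [s] and [t] from the
    same cleared sums. *)
Lemma flat_of_local : flat V.
Proof.
move=> N N' g g_inj s t gst.
pose good a := agree a s t.
have good_local (Q : prime_idealr S) : exists2 a, f a \notin Q & good a.
  have [a aQ [As At st]] := tensor_eq_agree Q gst; exists a => //.
  split=> [p ps|p pt|]; first by apply: (As (g p.1, p.2)); apply: map_f.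
    by apply: (At (g p.1, p.2)); apply: map_f.
  apply: g_inj; move: st; rewrite /cleared_sum !big_map !raddf_sum /= => st.
  by under eq_bigr do rewrite linearZ; under [RHS]eq_bigr do rewrite linearZ.
pose D : {pred S} := [pred x | `[< exists l : seq (R * S),
  (forall i, i \in l -> good i.1) /\ x = \sum_(i <- l) f i.1 * i.2 >]].
have DP x : reflect (exists l : seq (R * S),
    (forall i, i \in l -> good i.1) /\ x = \sum_(i <- l) f i.1 * i.2) (x \in D).
  exact: asboolP.
have [/DP[l [lgood l1]]|D1] := boolP (1 \in D).
  apply: tensor_trans (tensor_eq_cleared_sum l1 _) _ => [i /lgood[]//|].
  apply/tensor_sym/(tensor_trans (tensor_eq_cleared_sum l1 _)) => [i /lgood[]//|].
  have -> : [seq (cleared_sum i.1 s, i.2 : V) | i <- l]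
          = [seq (cleared_sum i.1 t, i.2 : V) | i <- l].
    by apply/eq_in_map => i /lgood[_ _ ->].
  exact: tensor_refl.
have [||||x ->//|P [[DQ _] _]] := @exists_minimal_prime _ D [set 1]%classic.
- by apply/DP; exists [::]; rewrite big_nil.
- move=> a u v /DP[l [lg ->]] /DP[l' [lg' ->]]; apply/DP.
  exists ([seq (i.1, a * i.2) | i <- l] ++ l'); split.
    by move=> i; rewrite mem_cat => /orP[/mapP[j /lg ? ->]|/lg'].
  rewrite big_cat big_map mulr_sumr; congr (_ + _).
  by apply: eq_bigr => i _; rewrite mulrCA.
- by [].
- by move=> x y -> ->; rewrite mulr1.
have [a /negP aP ag] := good_local P; case: aP; apply/DQ/DP.
exists [:: (a, 1)]; rewrite big_seq1 /= mulr1; split=> // i.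
by rewrite inE => /eqP->.
Qed.

End LocallyEqual.

(** * Localizations inside a field, going down and valuation domains *)

Lemma sub_localization (F : fieldType) (A : subringClosed F)
    (P : prime_idealr (subring A)) (x : subring A) :
  val x \in localization (to_field A) P.
Proof.
by apply/asboolP; exists x, 1; rewrite idealr1 rmorph1 divr1.
Qed.

Lemma val_notin_neq0 (F : fieldType) (A : subringClosed F)
    (P : prime_idealr (subring A)) (s : subring A) : s \notin P -> val s != 0.
Proof.
apply: contraNneq => s0; have -> : s = 0 by apply: val_inj.
exact: idealr0.
Qed.

(* [P' C_Q] meets [A] in [P']. *)
Lemma going_down_contraction (F : fieldType) (A C : subringClosed F)
    (sAC : {subset A <= C}) (Q : prime_idealr (subring C))
    (P' : prime_idealr (subring A)) (x : F) (p t : subring A) :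
    going_down sAC -> {subset P' <= Spec_map (incl sAC) Q} ->
    x \in localization (to_field C) Q ->
  p \in P' -> x * val p = val t -> t \in P'.
Proof.
move=> gd sP'P xQ pP' xpt.
set P := Spec_map _ Q in sP'P.
(* [E] is the extension of [P'] to [A_P]. It is a prime ideal contracting to [P'], because [P'] lies
   in [P]. *)
pose E : {pred subring (localization (to_field A) P)} :=
  [pred y | `[< exists a s, [/\ a \in P', s \notin P & val y * val s = val a] >]].
have EP y : reflect
    (exists a s, [/\ a \in P', s \notin P & val y * val s = val a]) (y \in E).
  exact: asboolP.
have fracE (y : subring (localization (to_field A) P)) :
    exists b w : subring A, w \notin P /\ val y * val w = val b.
  have /asboolP[b [w [wP ->]]] := valP y; exists b, w; split=> //.
  by rewrite divfK // (val_notin_neq0 wP).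
have notPM s w : s \notin P -> w \notin P -> s * w \notin P.
  by move=> sP wP; rewrite prime_idealrM negb_or sP.
have P1 : 1 \notin P by rewrite idealr1.
have [||E' E'E] := @exists_prime_idealr _ E.
- split.
  + by apply/EP; exists 0, 1; rewrite idealr0 mul0r.
  + apply/EP => -[a [s [aP' /negP sP]]]; rewrite mul1r => /val_inj sa.
    by apply/sP/sP'P; rewrite sa.
  + move=> r u v /EP[a [s [aP' sP ua]]] /EP[b [w [bP' wP vb]]].
    have [c [z [zP rc]]] := fracE r; apply/EP.
    exists (c * w * a + z * s * b), (z * s * w); split.
    * by rewrite rpredD ?idealMr.
    * exact: notPM (notPM _ _ zP sP) wP.
    * by move: ua vb rc; rewrite !(rmorphD, rmorphM) /= => <- <- <-; ring.
- move=> u v /EP[a [s [aP' sP ua]]].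
  have [c [z [zP uc]]] := fracE u; have [d [w [wP vd]]] := fracE v.
  have : c * d * s = z * w * a.
    apply: val_inj; move: ua uc vd; rewrite !rmorphM /= => <- <- <-.
    by ring.
  move=> /(congr1 (fun y => y \in P')); rewrite [RHS]idealMr // !prime_idealrM.
  move=> /orP[/orP[cP'|dP']|/sP'P sP'].
  + by apply/orP; left; apply/EP; exists c, z.
  + by apply/orP; right; apply/EP; exists d, w.
  + by rewrite sP' in sP.
(* Going down yields a prime [Q'] of [C_Q] over [E], hence over [P']. Since [x] is in [C_Q], the
   product [x * p = t] lies in [Q']. *)
have [Q' Q'E] := gd Q E'.
pose loc (y : subring A) : subring (localization (to_field A) P) :=
  Sub (val y) (sub_localization P y).
pose cl := incl (@localization_incl _ _ _ sAC Q).
have clE (y : subring A) : (cl (loc y) \in Q') = (y \in P').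
  have -> : (cl (loc y) \in Q') = (loc y \in Spec_map cl Q') by [].
  rewrite Q'E E'E; apply/EP/idP => [[a [s [aP' sP]]]|yP']; last first.
    by exists y, 1; rewrite SubK mulr1.
  rewrite SubK -rmorphM => /val_inj ys.
  by move: aP'; rewrite -ys prime_idealrM => /orP[//|/sP'P]; rewrite (negPf sP).
rewrite -clE; have -> : cl (loc t) = Sub x xQ * cl (loc p).
  by apply: val_inj; rewrite rmorphM !SubK.
by rewrite idealMr // clE.
Qed.

(** Phrased with elements of [F], the property depends only on membership in [V] and can be
    transported along [=i]. *)
Lemma valuation_domainP (F : fieldType) (V : subringClosed F) :
  valuation_domain V <->
  {in V &, forall a b, exists2 c, c \in V & a = c * b \/ b = c * a}.
Proof.
split=> [Vval a b aV bV|Vval a b].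
  pose a' : subring V := Sub a aV; pose b' : subring V := Sub b bV.
  have [[c /(congr1 val) cE]|[c /(congr1 val) cE]] := Vval a' b'; exists (val c).
  - exact: valP.
  - by left.
  - exact: valP.
  - by right.
have [c cV abE] := Vval _ _ (valP a) (valP b).
pose c' : subring V := Sub c cV.
by case: abE => cE; [left|right]; exists c'; apply: val_inj.
Qed.

Lemma valued_prime_eq (R : comNzRingType) (F : fieldType)
    (j : {rmorphism R -> F}) (P Q : prime_idealr R) :
  P =i Q -> valued_prime j P -> valued_prime j Q.
Proof.
move=> PQ /valuation_domainP Pval.
have PQloc : localization j P =i localization j Q.
  by move=> x; apply/asboolP/asboolP => -[a [s [sP xE]]]; exists a, s;
    rewrite (PQ, =^~ PQ).
apply/valuation_domainP => a b; rewrite -!PQloc => aP bP.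
by have [c cP abE] := Pval _ _ aP bP; exists c; rewrite -?PQloc.
Qed.

(** * Denominators of fractions over a P-domain *)

Section Fractions.
Variable B : idomainType.
Local Notation j := (embedding B).

Lemma embedding_inj : injective j.
Proof. by move=> x y /eqP; rewrite tofrac_eq => /eqP. Qed.

Lemma fractionE (x : {fraction B}) : exists a b, b != 0 /\ x * j b = j a.
Proof.
elim/quotW: x => r; exists \n_r, \d_r; split; first exact: denom_ratioP.
have jE c : j c = \pi_({fraction B})%qT (Ratio c 1).
  by rewrite -[j c]/(FracField.tofrac c); unlock FracField.tofrac.
rewrite !jE -[LHS]FracField.pi_mul.
apply/eqmodP; rewrite /= FracField.equivfE /FracField.mulf.
rewrite !numden_Ratio ?oner_neq0 ?mulr1 ?denom_ratioP //.
by rewrite mulrC.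
Qed.

(** Either [a / b] lies in the valuation ring [B_P], or its inverse lies in the maximal ideal. Both
    cases are written without denominators. *)
Lemma valued_primeP (P : prime_idealr B) (a b : B) :
    valued_prime j P -> b != 0 ->
  (exists2 s, s \notin P & exists u, s * a = u * b) \/
  (exists p t, [/\ p \in P, t \notin P & p * a = t * b]).
Proof.
move=> /valuation_domainP vP b0.
have loc c : j c \in localization j P.
  by apply/asboolP; exists c, 1; rewrite idealr1 rmorph1 divr1.
have j0 s : s \notin P -> j s != 0.
  by apply: contraNneq; rewrite -(rmorph0 j) => /embedding_inj ->; rewrite idealr0.
have [c /asboolP[u [s [sP ->]]] [abE|abE]] := vP _ _ (loc a) (loc b).
  left; exists s => //; exists u; apply: embedding_inj.
  by rewrite !rmorphM abE; field; apply: j0.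
have E : u * a = s * b.
  by apply: embedding_inj; rewrite !rmorphM abE; field; apply: j0.
have [uP|uP] := boolP (u \in P); first by right; exists u, s.
by left; exists u => //; exists s.
Qed.

(* Otherwise a minimal prime [P1] over the denominator ideal of [x] misses
   [A \ Q].  It is valued, so [x^-1 = p / t] with [p \in P1] and [t \notin P1],
   and [x p = t] contradicts [P1 C_Q :&: A = P1 :&: A]. *)
Lemma going_down_denominator (A : subringClosed B) (C : subringClosed {fraction B})
    (sAC : {subset embedded A <= C}) (Q : prime_idealr (subring C)) x :
    P_domain B ->
    (forall P : prime_idealr B, valued_prime j P ->
      exists2 e, e \notin P & forall b, e * b \in A) ->
    going_down sAC -> x \in localization (to_field C) Q ->
  exists s b, s \notin Spec_map (incl sAC) Q /\ x * val s = j b.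
Proof.
move=> PB conductor gd xQ; apply: contrapT => noden.
set P := Spec_map _ Q in noden.
have [a [b [b0 xE]]] := fractionE x.
have jb0 : j b != 0 by rewrite tofrac_eq0.
(* [S] is the complement of [P] in [A], viewed in [B], while [colon b a] is the ideal of
   denominators of [x = a / b]. The two are disjoint by [noden]. *)
pose S := [set c | exists2 s, s \notin P & val s = j c]%classic.
have colonP y : reflect (exists z, y * a = z * b) (y \in colon b a).
  exact: asboolP.
have [||||c [s sP sc]|P1 [P1min P1S]] := @exists_minimal_prime _ (colon b a) S.
- by apply/colonP; exists 0; rewrite !mul0r.
- move=> c u v /colonP[y yE] /colonP[z zE]; apply/colonP.
  by exists (c * y + z); rewrite !mulrDl -!mulrA yE zE.
- by exists 1; rewrite ?idealr1 // !rmorph1.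
- move=> c d [s sP sc] [t tP td]; exists (s * t).
    by rewrite prime_idealrM negb_or sP.
  by rewrite !rmorphM -sc -td.
- apply/negP => /colonP[z zE]; apply: noden; exists s, z; split=> //.
  apply: (mulIf jb0); rewrite sc mulrAC xE -!rmorphM; congr (j _).
  by rewrite mulrC.
have vP1 : valued_prime j P1 by apply: PB; exists b, a.
have [e eP1 eA] := conductor _ vP1.
have Aj c : c \in A -> j c \in embedded A by move=> cA; apply/asboolP; exists c.
(* [P1A] is the contraction of [P1] to [A]. It lies inside [P] because [P1] misses [S]. *)
pose P1A : {pred subring (embedded A)} :=
  [pred s | `[< exists2 c, c \in P1 & val s = j c >]].
have P1AP s : reflect (exists2 c, c \in P1 & val s = j c) (s \in P1A).
  exact: asboolP.
have AE (s : subring (embedded A)) : exists2 c, c \in A & val s = j c.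
  by have /asboolP := valP s.
have [||P' P'E] := @exists_prime_idealr _ P1A.
- split.
  + by apply/P1AP; exists 0; rewrite ?idealr0 ?rmorph0.
  + apply/P1AP => -[c cP1]; rewrite rmorph1 -(rmorph1 j) => /embedding_inj cE.
    by move: cP1; rewrite -cE idealr1.
  + move=> r s t /P1AP[c cP1 cE] /P1AP[d dP1 dE]; have [f _ fE] := AE r.
    apply/P1AP; exists (f * c + d); first by rewrite rpredD ?idealMr.
    by rewrite !(rmorphD, rmorphM) -fE -cE -dE.
- move=> s t /P1AP[c cP1]; have [d _ dE] := AE s; have [f _ fE] := AE t.
  rewrite rmorphM /= dE fE -rmorphM => /embedding_inj cE.
  move: cP1; rewrite -cE prime_idealrM => /orP[]; last first.
    by move=> fP1; apply/orP; right; apply/P1AP; exists f.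
  by move=> dP1; apply/orP; left; apply/P1AP; exists d.
have sP'P : {subset P' <= P}.
  move=> s; rewrite P'E => /P1AP[c cP1 cE]; apply/negPn/negP => sP.
  by have /negP[] := P1S c (ex_intro2 _ _ s sP cE).
(* The first alternative would give a denominator of [x] outside [P1], although [P1] contains them
   all. *)
have [[s sP1 /colonP sD]|[p [t [pP1 tP1 pt]]]] := valued_primeP a vP1 b0.
  by have [/(_ s sD)] := P1min; rewrite (negPf sP1).
have xpt : x * j p = j t.
  by apply: (mulIf jb0); rewrite mulrAC xE -!rmorphM mulrC pt.
(* The elements [p] and [t] need not lie in [A]. Multiplying by [e], which is outside [P1], moves
   both into [A] and keeps [e * t] outside [P1]. *)
have : Sub (j (e * t)) (Aj _ (eA t)) \in P'.
  apply: (going_down_contraction (p := Sub (j (e * p)) (Aj _ (eA p))) gd sP'P xQ).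
    by rewrite P'E; apply/P1AP; exists (e * p); rewrite ?SubK // idealMr.
  by rewrite !SubK !rmorphM mulrCA xpt.
rewrite P'E => /P1AP[c cP1]; rewrite SubK => /embedding_inj cE.
by move: cP1; rewrite -cE prime_idealrM (negPf eP1) (negPf tP1).
Qed.

End Fractions.

(** * The pullback of the diagonal and its local comparison with an overring *)

Section PullbackDomain.
Variables (B : idomainType) (K : fieldType) (n : nat).
Variables (M : 'I_n -> prime_idealr B).
Variables (sigma : forall i, {rmorphism {ideal_quot (M i)} -> K}).
Hypothesis M_max : forall i, maximal_ideal (M i).
Hypothesis M_inj : forall i k, M i =i M k -> i = k.
Hypothesis sigma_bij : forall i, bijective (sigma i).

Local Notation j := (embedding B).
Local Notation A := (embedded (pullback sigma)).

Definition residue i (b : B) : K := sigma i (\pi_({ideal_quot (M i)})%qT b).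

Let residueB i : {morph residue i : a b / a - b}.
Proof. by move=> a b; rewrite /residue !rmorphB. Qed.

Let residueM i : {morph residue i : a b / a * b}.
Proof. by move=> a b; rewrite /residue !rmorphM. Qed.

Let residue1 i : residue i 1 = 1.
Proof. by rewrite /residue !rmorph1. Qed.

Let mem_residue i b : (b \in M i) = (residue i b == 0).
Proof.
rewrite -[b]subr0 Quotient.idealrBE subr0 /residue.
by rewrite -(inj_eq (bij_inj (sigma_bij i))) !rmorph0.
Qed.

Lemma pullbackP b :
  reflect (exists x, forall i, residue i b = x) (b \in pullback sigma).
Proof.
apply: (iffP (asboolP _)) => -[x bx]; exists x.
  by move=> i; have /ffunP/(_ i) := bx; rewrite !ffunE.
by apply/ffunP=> i; rewrite !ffunE; apply: bx.
Qed.

(** Chinese remainders: [e i] lies in every [M k] with [k] different from [i] but not in [M i], so a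
    multiple of it adjusts the residue at [i] alone. *)
Lemma exists_residue x : exists b, forall i, residue i b = x.
Proof.
have sep (p : 'I_n * 'I_n) :
    exists m, p.1 != p.2 -> m \in M p.2 /\ m \notin M p.1.
  have [->|ik] := eqVneq p.1 p.2; first by exists 0.
  suff [m mk mi] : exists2 m, m \in M p.2 & m \notin M p.1 by exists m.
  apply: contrapT => noM; case/eqP: ik; apply: M_inj.
  apply: (M_max (J := M p.1)) => m mk.
  by apply/negPn/negP => mi; apply: noM; exists m.
have [m mP] := fin_all_exists sep.
pose e i := \prod_(k | k != i) m (i, k).
have eM i k : k != i -> e i \in M k.
  move=> ki; rewrite /e (bigD1 k) //= mulrC idealMr //.
  by have [] := mP (i, k); rewrite // eq_sym.
have eN i : e i \notin M i.
  apply: (big_ind (fun b => b \notin M i)); first by rewrite idealr1.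
    by move=> a b aM bM; rewrite prime_idealrM negb_or aM.
  by move=> k ki; have [] := mP (i, k); rewrite // eq_sym.
have lift i y : exists b, residue i b = y.
  have [g _ sg] := sigma_bij i; exists (repr (g y)).
  by rewrite /residue reprK sg.
(* The division compensates for [e i] being only nonzero, not [1], modulo [M i]. *)
have [b bE] := fin_all_exists (fun i => lift i (x / residue i (e i))).
exists (\sum_i b i * e i) => k.
rewrite /residue !rmorph_sum (bigD1 k) //= -/(residue k _) residueM bE.
rewrite divfK; last first.
  by rewrite -mem_residue.
rewrite big1 ?addr0 // => i ik; apply/eqP; rewrite -/(residue k _) -mem_residue.
by rewrite idealMr // eM // eq_sym.
Qed.

(** A valued prime containing some [M i] would equal it by maximality. Hence each [M i] has an
    element outside [P], and [e] is the product of these. *)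
Lemma valued_prime_avoids (P : prime_idealr B) :
    (forall i, ~ valued_prime j (M i)) -> valued_prime j P ->
  exists2 e, e \notin P & forall i, e \in M i.
Proof.
move=> M_nv P_v.
have sep i : exists m, m \in M i /\ m \notin P.
  apply: contrapT => noM; apply: (M_nv i); apply: valued_prime_eq P_v.
  apply: (M_max (J := P)) => m mM.
  by apply/negPn/negP => mP; apply: noM; exists m.
have [m mP] := fin_all_exists sep; exists (\prod_i m i).
  apply: (big_ind (fun b => b \notin P)); first by rewrite idealr1.
    by move=> a b aM bM; rewrite prime_idealrM negb_or aM.
  by move=> i _; have [] := mP i.
by move=> i; rewrite (bigD1 i) //= mulrC idealMr //; have [] := mP i.
Qed.

Lemma inter_pullback e : (forall i, e \in M i) -> e \in pullback sigma.
Proof.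
by move=> eM; apply/pullbackP; exists 0 => i; apply/eqP; rewrite -mem_residue.
Qed.

Lemma embeddedP (s : subring A) : exists2 b, b \in pullback sigma & val s = j b.
Proof. by have /asboolP := valP s. Qed.

Lemma exists_val b : b \in pullback sigma -> exists s : subring A, val s = j b.
Proof.
move=> bA; have bj : j b \in A by apply/asboolP; exists b.
by exists (Sub (j b) bj).
Qed.

(* [I = \bigcap_i M i] is a maximal ideal of [A]. *)
Lemma inter_maximal (P : prime_idealr (subring A)) (s : subring A) b :
    (forall (t : subring A) e, (forall i, e \in M i) -> val t = j e -> t \in P) ->
  s \in P -> val s = j b -> forall i, b \in M i.
Proof.
move=> IP sP sE.
have [c cA] := embeddedP s; rewrite sE => /embedding_inj bc; subst c.
have /pullbackP[x bx] := cA; have [x0|x0] := eqVneq x 0.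
  by move=> i; rewrite mem_residue bx x0.
(* If [x] is nonzero, its inverse lifts to [c] in [A]. Then [c * b - 1] has zero residues and lies
   in [P], which together with [s] in [P] puts [1] in [P]. *)
have [c cE] := exists_residue x^-1.
have [t tE] : exists t : subring A, val t = j c.
  by apply/exists_val/pullbackP; exists x^-1.
suff : 1 \in P by rewrite idealr1.
have -> : 1 = t * s - (t * s - 1) by rewrite opprB addrC subrK.
rewrite rpredB ?idealMr //; apply: (IP _ (c * b - 1)).
  by move=> i; rewrite mem_residue residueB residueM cE bx residue1 mulVf // subrr.
by rewrite !(rmorphB, rmorphM, rmorph1) /= -tE -sE.
Qed.

(** This supplies the local hypothesis of [flat_of_local] for the inclusion of [A] in [C]. *)
Lemma pullback_local (C : subringClosed {fraction B}) (sAC : {subset A <= C})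
    (Q : prime_idealr (subring C)) (c : subring C) :
    P_domain B -> (0 < n)%N -> (forall i, ~ valued_prime j (M i)) ->
    going_down sAC ->
  exists s a : subring A, incl sAC s \notin Q /\ incl sAC s * c = incl sAC a.
Proof.
move=> PB n0 M_nv gd; set P := Spec_map (incl sAC) Q.
(* The conductor condition holds because a valued prime misses some [e] in every [M i], and all
   multiples of [e] lie in the pullback. *)
have den x : x \in localization (to_field C) Q ->
    exists (s : subring A) b, s \notin P /\ x * val s = j b.
  apply: going_down_denominator => // P' /(valued_prime_avoids M_nv)[e eP eM].
  by exists e => // b; apply: inter_pullback => i; rewrite mulrC idealMr ?eM.
have [s [b [sP sb]]] := den _ (sub_localization Q c).
(* If the intersection of the [M i] has an element [e] outside [P], then [b * e] lies in that
   intersection, so [s * t] is a denominator with numerator in [A]. *)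
have [[t [e [tP eM te]]]|IP] :=
    pselect (exists (t : subring A) e,
      [/\ t \notin P, forall i, e \in M i & val t = j e]).
  have [a aE] : exists a : subring A, val a = j (b * e).
    by apply/exists_val/inter_pullback => i; rewrite idealMr ?eM.
  exists (s * t), a; split.
    have := prime_idealrM P s t.
    by rewrite (negPf sP) (negPf tP) => /negbT.
  apply: val_inj; rewrite !rmorphM !SubK aE rmorphM -sb -te.
  by rewrite mulrAC [val s * _]mulrC.
have {}IP (t : subring A) e : (forall i, e \in M i) -> val t = j e -> t \in P.
  by move=> eM te; apply/negPn/negP => tP; apply: IP; exists t, e.
have jC a : a \in pullback sigma -> j a \in C.
  by move=> aA; rewrite sAC //; apply/asboolP; exists a.
have bC : j b \in C.
  by rewrite -sb rpredM ?(valP c) //; have := sAC _ (valP s).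
(* Otherwise [(b - a)^-1 = w / t] with [w \in B] and [t \in A \ P], but then
   [t = w (b - a)] has a zero residue, hence only zero residues. *)
have bQ i a (bC' : j (b - a) \in C) : residue i a = residue i b ->
    (Sub (j (b - a)) bC' : subring C) \in Q.
  move=> ab; apply/negPn/negP => bQ.
  have inv : (j (b - a))^-1 \in localization (to_field C) Q.
    by apply/asboolP; exists 1, (Sub (j (b - a)) bC'); rewrite rmorph1 div1r.
  have [t [w [tP tw]]] := den _ inv; have [d dA td] := embeddedP t.
  have ba0 : j (b - a) != 0 by have := val_notin_neq0 bQ; rewrite SubK.
  have dE : d = w * (b - a).
    by apply: embedding_inj; rewrite rmorphM -td -tw mulrC mulVKf.
  have /pullbackP[x dx] := dA.
  have x0 : x = 0.
    by rewrite -(dx i) dE residueM residueB ab subrr mulr0.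
  by case/negP: tP; apply: IP td => k; rewrite mem_residue dx x0.
(* Take [a] and [a'] in [A] with constant residues equal to those of [b] at [i] and [k]. Both
   [b - a] and [b - a'] lie in [Q], so [a - a'] lies in [P], where all residues vanish, and the two
   constants coincide. *)
have residue_const i k : residue i b = residue k b.
  have [a aE] := exists_residue (residue i b).
  have [a' a'E] := exists_residue (residue k b).
  have aA : a \in pullback sigma by apply/pullbackP; exists (residue i b).
  have aA' : a' \in pullback sigma by apply/pullbackP; exists (residue k b).
  have baC : j (b - a) \in C by rewrite rmorphB; apply: rpredB (jC _ _).
  have baC' : j (b - a') \in C by rewrite rmorphB; apply: rpredB (jC _ _).
  have [t tE] : exists t : subring A, val t = j (a - a').
    by apply/exists_val; rewrite rpredB.
  have tP : t \in P.
    rewrite -[t \in P]/(incl sAC t \in Q).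
    have -> : incl sAC t = Sub (j (b - a')) baC' - Sub (j (b - a)) baC.
      apply: val_inj; transitivity (j (b - a') - j (b - a)); last by [].
      by rewrite SubK tE -rmorphB; congr (j _); ring.
    by apply: rpredB; [apply: (bQ k); rewrite a'E|apply: (bQ i); rewrite aE].
  have /(_ i) := inter_maximal IP tP tE.
  by rewrite mem_residue residueB aE a'E subr_eq0 => /eqP.
have [a aE] : exists a : subring A, val a = j b.
  by apply/exists_val/pullbackP; exists (residue (Ordinal n0) b).
exists s, a; split=> //.
by apply: val_inj; rewrite rmorphM !SubK aE mulrC.
Qed.

End PullbackDomain.

Theorem theorem10 (B : idomainType) (K : fieldType) (n : nat)
    (M : 'I_n -> prime_idealr B)
    (sigma : forall i : 'I_n, {rmorphism {ideal_quot (M i)} -> K}) :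
  P_domain B ->
  (1 <= n)%N ->
  (forall i : 'I_n, maximal_ideal (M i)) ->
  (forall i j : 'I_n, M i =i M j -> i = j) ->
  (forall i : 'I_n, ~ valued_prime (embedding B) (M i)) ->
  (forall i : 'I_n, bijective (sigma i)) ->
  perinormal (embedded (pullback sigma)).
Proof.
move=> PB n0 M_max M_inj M_nv sigma_bij C sAC _ gd.
apply: flat_of_local => [x y /(congr1 val)|Q c].
  by rewrite !SubK; apply: val_inj.
exact: pullback_local.
Qed.
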